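(* Let $S$ be an inverse semigroup without zero and let $E$ be the semilattice of idempotents of $S$. For all $a, b \in S$, the following statements are equivalent: (i) $(a, b) \notin \sigma$; (ii) $a$ and $b$ are adjacent in $\Gamma(S^0)$; (iii) $E^0 a \cap E^0 b = \{0\}$.
   Context: For an inverse semigroup $T$ with set of idempotents $E(T)$, the natural partial order is: $a \le b$ iff $a = eb$ for some $e \in E(T)$. A semigroup ''with zero'' is one with at least two elements containing an element $0$ such that $0x = x0 = 0$ for all $x$; thus a one-element semigroup counts as being without zero. If $S$ has no zero, $S^0 = S \cup \{0\}$ denotes $S$ with an external zero adjoined, and $E^0 = E \cup \{0\}$ is its set of idempotents. For an inverse semigroup $T$ with zero and $a, b \in T$, $\omega(a,b) = \{c \in T : c \le a \text{ and } c \le b\}$. The zero-divisor graph $\Gamma(T)$ is the simple undirected graph with vertex set $Z(T)^\times = \{a \in T\setminus\{0\} : \exists\, b \in T \setminus\{0\},\ \omega(a,b) = \{0\}\}$, in which two distinct vertices $a, b$ are adjacent iff $\omega(a,b) = \{0\}$. The least group congruence $\sigma$ on $S$ is given by: $a\,\sigma\,b$ iff $ea = fb$ for some $e, f \in E(S)$. *)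

(* Defs.v *)
From HB Require Import structures.
From mathcomp Require Import all_boot.
From mathcomp Require Import boolp classical_sets.

Set Implicit Arguments.
Unset Strict Implicit.
Unset Printing Implicit Defensive.

Import Algebra.
Local Open Scope classical_set_scope.
Local Open Scope group_scope.

(* [semigroupType] allows an empty carrier; [nonempty_sg] restores the usual
   convention that semigroups are nonempty. *)
HB.mixin Record Semigroup_isInverse S of Semigroup S := {
  nonempty_sg : inhabited S;
  inverse_sg : forall x : S, exists! y : S, x * y * x = x /\ y * x * y = y
}.

#[short(type="inverseSemigroupType")]
HB.structure Definition InverseSemigroup :=
  {S of Semigroup_isInverse S & Semigroup S}.

(* The first conjunct makes a one-element semigroup a semigroup without zero. *)
Definition is_zero (T : magmaType) (z : T) : Prop :=
  (exists x : T, x <> z) /\ (forall x : T, z * x = z /\ x * z = z).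

Definition without_zero (T : magmaType) : Prop := ~ exists z : T, is_zero z.

HB.mixin Record Magma_hasZero T of Magma T := {
  zero_sg : T;
  zero_sgP : is_zero zero_sg
}.

#[short(type="inverseSemigroup0Type")]
HB.structure Definition InverseSemigroup0 :=
  {T of Magma_hasZero T & InverseSemigroup T}.

Definition idempotents (T : magmaType) : set T := [set e | e * e = e].
Arguments idempotents : clear implicits.

Definition natural_le (T : inverseSemigroupType) (a b : T) : Prop :=
  exists2 e, idempotents T e & a = e * b.

Definition sigma (S : inverseSemigroupType) (a b : S) : Prop :=
  exists e f, [/\ idempotents S e, idempotents S f & e * a = f * b].

Definition omega (T : inverseSemigroupType) (a b : T) : set T :=
  [set c | natural_le c a /\ natural_le c b].

Record simple_graph (T : Type) := SimpleGraph {
  vertices : set T;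
  adjacent : T -> T -> Prop;
  adjacent_vertices : forall a b, adjacent a b -> vertices a /\ vertices b;
  adjacent_irrefl : forall a, ~ adjacent a a;
  adjacent_sym : forall a b, adjacent a b -> adjacent b a
}.

Section ZeroDivisorGraph.
Variable T : inverseSemigroup0Type.
Implicit Types a b : T.

Definition zdg_vertices : set T :=
  [set a | a <> zero_sg /\
           exists2 b : T, b <> zero_sg & omega a b = [set zero_sg]].

Definition zdg_adjacent a b : Prop :=
  [/\ zdg_vertices a, zdg_vertices b, a <> b & omega a b = [set zero_sg]].

Lemma zdg_adjacent_vertices a b :
  zdg_adjacent a b -> zdg_vertices a /\ zdg_vertices b.
Proof. by case. Qed.

Lemma zdg_adjacent_irrefl a : ~ zdg_adjacent a a.
Proof. by case. Qed.

Lemma omegaC a b : omega a b = omega b a.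
Proof. by apply/seteqP; split=> c []. Qed.

Lemma zdg_adjacent_sym a b : zdg_adjacent a b -> zdg_adjacent b a.
Proof. by case=> va vb nab w; split=> //; [move=> /esym | rewrite omegaC]. Qed.

Definition zero_divisor_graph : simple_graph T :=
  SimpleGraph zdg_adjacent_vertices zdg_adjacent_irrefl zdg_adjacent_sym.

End ZeroDivisorGraph.
Arguments zero_divisor_graph : clear implicits.

(* The semigroup S^0: [Some] embeds S, and [None] is the external zero. *)
Definition adjoin_zero (S : Type) : Type := option S.

Section AdjoinZero.
Variable S : inverseSemigroupType.
Local Notation S0 := (adjoin_zero S).

HB.instance Definition _ := Choice.on S0.

Definition adjoin_zero_mul (x y : S0) : S0 :=
  match x, y with Some a, Some b => Some (a * b) | _, _ => None end.

Lemma adjoin_zero_mulA : associative adjoin_zero_mul.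
Proof. by move=> [a|] [b|] [c|] //=; rewrite mulgA. Qed.

HB.instance Definition _ := isSemigroup.Build S0 adjoin_zero_mulA.

Lemma adjoin_zero_nonempty : inhabited S0.
Proof. by constructor; exact: None. Qed.

Lemma adjoin_zero_inverse (x : S0) :
  exists! y : S0, x * y * x = x /\ y * x * y = y.
Proof.
case: x => [a|]; last by exists None; split=> // -[b|] // [].
have [b [[aba bab] b_uniq]] := inverse_sg a.
exists (Some b); split; first by split; congr Some.
by move=> [c|] [] // [aca] [cac]; congr Some; apply: b_uniq.
Qed.

HB.instance Definition _ :=
  Semigroup_isInverse.Build S0 adjoin_zero_nonempty adjoin_zero_inverse.

Lemma adjoin_zero_zero : is_zero (None : S0).
Proof.
split; last by case.
by have [a] := @nonempty_sg S; exists (Some a).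
Qed.

HB.instance Definition _ := Magma_hasZero.Build S0 adjoin_zero_zero.

Definition embed (a : S) : S0 := Some a.

Definition E0 : set S0 := embed @` idempotents S `|` [set zero_sg].

Lemma E0E : E0 = idempotents S0.
Proof.
apply/seteqP; split=> [x [[e ee <-]|->] //|[e|] ee].
- by rewrite /idempotents /= /mul /= ee.
- by left; exists e => //; case: ee.
- by right.
Qed.

Definition E0_mul (x : S0) : set S0 := [set e * x | e in E0].

End AdjoinZero.

(* Main.v *)
(* By E^0 = E(S^0), the set omega(a, b) is E^0 a \cap E^0 b; its nonzero
   elements are the common values e a = f b witnessing a sigma b. *)
Require Import Defs.
From mathcomp Require Import all_boot.
From mathcomp Require Import boolp classical_sets.

Local Open Scope classical_set_scope.

(** Each statement amounts to [omega a b] being zero in S^0, since a nonzero common lower bound is a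
    value [e a = f b], witnessing [sigma a b]. Adjacency also asks for distinct vertices; this is
    then automatic, as [a] and [b] are nonzero and [sigma] is reflexive. *)

Lemma sigma_refl (S : inverseSemigroupType) (a : S) : sigma a a.
Proof.
(* Any idempotent serves on both sides; the inverse [y] of [a] provides one. *)
have [y [[aya _] _]] := inverse_sg a.
have idem_ay : idempotents S (mul a y) by rewrite /idempotents /= mulgA aya.
by exists (mul a y), (mul a y).
Qed.

Lemma omega_E0_mul (S : inverseSemigroupType) (x y : adjoin_zero S) :
  omega x y = E0_mul x `&` E0_mul y.
Proof.
rewrite /E0_mul E0E; apply/seteqP; split=> c.
  by move=> [[e ee ->] [f ef eq_f]]; split; [exists e | exists f].
by move=> [[e ee <-] [f ef eq_f]]; split; [exists e | exists f].
Qed.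

Lemma omega_embedP (S : inverseSemigroupType) (a b : S) :
  omega (embed a) (embed b) = [set zero_sg] <-> ~ sigma a b.
Proof.
split=> [omega0 [e [f [ee ef eq_ef]]] | nsigma].
  have: omega (embed a) (embed b) (embed (mul e a)).
    split; first by exists (embed e) => //; congr Some.
    by exists (embed f); [congr Some | rewrite eq_ef].
  by rewrite omega0.
rewrite omega_E0_mul; apply/seteqP; split=> [c | _ ->]; last first.
  by split; exists zero_sg => //; right.
(* If neither multiplier is zero, the two forms of [c] give [f b = e a] in [S], against [nsigma]. *)
move=> [[_ [[e ee <-]|->] <-] [_ [[f ef <-]|->]]] //= [eq_fe].
by case: nsigma; exists e, f.
Qed.

Theorem lemma4p1 (S : inverseSemigroupType) (S_no_zero : without_zero S)
    (a b : S) :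
  [<-> ~ sigma a b;
       adjacent (zero_divisor_graph (adjoin_zero S)) (embed a) (embed b);
       E0_mul (embed a) `&` E0_mul (embed b) = [set zero_sg]].
Proof.
tfae=> [nsigma | [_ _ _] | ].
- have omega0 := (omega_embedP S a b).2 nsigma.
  (* Each of [a], [b] makes the other a vertex. *)
  split=> //; last by case=> eq_ab; apply: nsigma; rewrite eq_ab; apply: sigma_refl.
    by split=> //; exists (embed b).
  by split=> //; exists (embed a) => //; rewrite omegaC.
- by rewrite omega_E0_mul.
- by rewrite -omega_E0_mul => /omega_embedP.
Qed.
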